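(* For every finite collection $\Sigma$ of effectively presented feed models and every profile pseudometric $\delta$ with decidable grid comparisons $\lceil\delta(S,T)\rceil_G\le r$ ($S,T\subseteq P$, $r\in G$), the satisfiability problem and the validity problem for $\mathcal{L}_D$-formulas over network models (relative to $\delta$) are decidable.
   Context: Fix a positive integer $m$ and $G=\{0,\frac1m,\ldots,1\}$; $r\oplus s=\min\{1,r+s\}$ for $r,s\in G$; for $x\in[0,1]$, $\lceil x\rceil_G:=\min\{r\in G:x\le r\}$. Let $A$ be a finite nonempty set of agents, $P$ a nonempty finite set of propositional atoms, $\Omega$ a finite set of nominals, $P\cap\Omega=\varnothing$, $|\Omega|=|A|$. Profile pseudometric: $\delta:\wp(P)\times\wp(P)\to[0,1]$ with $\delta(S,S)=0$, $\delta(S,T)=\delta(T,S)$, $\delta(S,U)\le\delta(S,T)+\delta(T,U)$ for all $S,T,U\subseteq P$. Static network model: $M=(A,(\sim_r)_{r\in G},V)$ where $V:P\cup\Omega\to\wp(A)$, each $V(i)$ ($i\in\Omega$) is a singleton and $i\mapsto$ (the unique member of $V(i)$) is a bijection $\Omega\to A$; the relations $\sim_r\subseteq A\times A$ satisfy, for all $a,b,c\in A$ and $r,s\in G$: $a\sim_r a$; $a\sim_r b\Leftrightarrow b\sim_r a$; $a\sim_1 b$; $a\sim_r b\Rightarrow a\sim_s b$ for $r\le s$; $a\sim_r b$ and $b\sim_s c$ imply $a\sim_{r\oplus s}c$. Profile: $S_V(a):=\{p\in P:a\in V(p)\}$. Network model (relative to $\delta$): $N=(A,(\sim_r)_{r\in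 G},V)$ with $V$ satisfying the same naming condition and $a\sim_r b$ iff $\lceil\delta(S_V(a),S_V(b))\rceil_G\le r$, for all $a,b\in A$, $r\in G$. (Every network model is a static network model.) Static language $\mathcal{L}_0$: $\varphi::=p\mid i\mid\neg\varphi\mid(\varphi\land\psi)\mid\langle r\rangle\varphi\mid@_i\varphi$ ($p\in P,i\in\Omega,r\in G$). Semantics: $M,a\models p$ iff $a\in V(p)$; $M,a\models i$ iff $a\in V(i)$; Boolean clauses as usual; $M,a\models\langle r\rangle\varphi$ iff $M,b\models\varphi$ for some $b$ with $a\sim_r b$; $M,a\models@_i\varphi$ iff $M,b\models\varphi$ where $V(i)=\{b\}$. For $\chi\in\mathcal{L}_0$, $\models\chi$ means $\chi$ is true at every agent of every static network model. Feed model: $\mathcal{F}=(E,\mathrm{pre},\mathrm{post})$ with $E$ a finite nonempty set of events, $\mathrm{pre}:E\to\mathcal{L}_0$, $\mathrm{post}:E\times P\to\mathcal{L}_0$ total, $\models\bigvee_{e\in E}\mathrm{pre}(e)$, and $\models\neg(\mathrm{pre}(e)\land\mathrm{pre}(f))$ for $e\ne f$ in $E$. It is effectively presented when $E$, $\mathrm{pre}$, $\mathrm{post}$ are explicitly given. For a network model $M$ and $a\in A$ let $e_a$ be the unique event with $M,a\models\mathrm{pre}(e_a)$. Update: $M\otimes\mathcal{F}=(A,(\sim^\otimes_r)_{r\in G},V^\otimes)$ with $a\in V^\otimes(p)$ iff $M,a\models\mathrm{post}(e_a,p)$ ($p\in P$), $V^\otimes(i)=V(i)$ ($i\in\Omega$),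 and $a\sim^\otimes_r b$ iff $\lceil\delta(S_{V^\otimes}(a),S_{V^\otimes}(b))\rceil_G\le r$. Dynamic language $\mathcal{L}_D$: the grammar of $\mathcal{L}_0$ plus $[\mathcal{F}]\varphi$ for $\mathcal{F}\in\Sigma$. Formulas are evaluated at agents of network models, with the static clauses above and $M,a\models[\mathcal{F}]\varphi$ iff $M\otimes\mathcal{F},a\models\varphi$. A formula is satisfiable over network models if it is true at some agent of some network model, and valid if it is true at every agent of every network model. *)

(* Defs.v *)
From HB Require Import structures.
From mathcomp Require Import all_boot all_order all_algebra.
From mathcomp Require Import reals.

Set Implicit Arguments.
Unset Strict Implicit.
Unset Printing Implicit Defensive.

Import Order.TTheory GRing.Theory Num.Theory.
Local Open Scope ring_scope.

(* Deterministic single-tape Turing machines with a two-way infinite tape.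
   A cell is [None] (blank), [Some (inl x)] with [x] an input letter, or
   [Some (inr y)] with [y] an auxiliary work letter. *)
Record turing_machine (X : finType) := TuringMachine {
  tm_work : finType;
  tm_state : finType;
  tm_start : tm_state;
  (* [Some true]: accept and halt; [Some false]: reject and halt;
     [None]: the machine keeps running *)
  tm_verdict : tm_state -> option bool;
  (* new state, letter written, direction ([true] is right) *)
  tm_trans : tm_state -> option (X + tm_work) ->
             tm_state * option (X + tm_work) * bool
}.

Section Computability.
Variable X : finType.

Definition tm_cell (T : turing_machine X) := option (X + tm_work T).

(* [tm_left] lists the cells left of the head starting with the nearest one,
   [tm_right] those right of it; all further cells are blank. *)
Record tm_config (T : turing_machine X) := TMConfig {
  tm_cur : tm_state T;
  tm_left : seq (tm_cell T);
  tm_head : tm_cell T;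
  tm_right : seq (tm_cell T)
}.

Definition tm_init (T : turing_machine X) (w : seq X) : tm_config T :=
  let cells := [seq Some (inl x) | x <- w] in
  TMConfig (tm_start T) [::] (head None cells) (behead cells).

(* Halting configurations are fixed, so that the verdict of a run is unique. *)
Definition tm_step (T : turing_machine X) (c : tm_config T) : tm_config T :=
  let: TMConfig q l h r := c in
  if tm_verdict q is Some _ then c else
  let: (q', h', d) := tm_trans q h in
  if d then TMConfig q' (h' :: l) (head None r) (behead r)
  else TMConfig q' (behead l) (head None l) (h' :: r).

Definition tm_decides (T : turing_machine X) (L : seq X -> Prop) : Prop :=
  forall w : seq X, exists n : nat, exists b : bool,
    tm_verdict (tm_cur (iter n (@tm_step T) (tm_init T w))) = Some b
    /\ (b <-> L w).

Definition decidable_language (L : seq X -> Prop) : Prop :=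
  exists T : turing_machine X, tm_decides T L.

(* The machine also has to reject the words that do not encode an instance. *)
Definition decidable_problem (I : Type) (encode : I -> seq X) (Q : I -> Prop) :
    Prop :=
  decidable_language (fun w => exists2 x : I, w = encode x & Q x).

End Computability.

(* The grid {0, 1/m, ..., 1} is represented by the numerators 0, ..., m. *)
Section Grid.
Variables (R : realType) (m : nat).

Definition grid_val (r : 'I_m.+1) : R := r%:R / m%:R.

Definition grid_oplus (r s : 'I_m.+1) : 'I_m.+1 := inord (minn m (r + s)).

Definition grid_ceil (x : R) : 'I_m.+1 :=
  [arg min_(r < ord_max | x <= grid_val r) grid_val r]%O.

Lemma grid_val_le (r s : 'I_m.+1) :
  (0 < m)%N -> (grid_val r <= grid_val s) = (r <= s)%N.
Proof.
by move=> m_gt0; rewrite ler_pM2r ?ler_nat // invr_gt0 ltr0n.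
Qed.

Lemma grid_val_max : (0 < m)%N -> grid_val ord_max = 1.
Proof. by move=> m_gt0; rewrite /grid_val divff // pnatr_eq0 -lt0n. Qed.

Lemma grid_val_oplus (r s : 'I_m.+1) :
  (0 < m)%N ->
  grid_val (grid_oplus r s) = Num.min 1 (grid_val r + grid_val s).
Proof.
move=> m_gt0; rewrite -(grid_val_max m_gt0) /grid_val inordK ?ltnS ?geq_minl //.
rewrite -mulrDl -natrD minEle ler_pM2r ?invr_gt0 ?ltr0n // ler_nat /minn /=.
by case: ltngtP => // {1}<-.
Qed.

Lemma grid_ceilP (x : R) : (0 < m)%N -> x <= 1 ->
  x <= grid_val (grid_ceil x) /\
  forall r, x <= grid_val r -> (grid_ceil x <= r)%N.
Proof.
move=> m_gt0 x1; rewrite /grid_ceil.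
case: Order.TotalTheory.arg_minP; first by rewrite grid_val_max.
by move=> r xr rmin; split=> // s /rmin; rewrite grid_val_le.
Qed.

End Grid.

Section Syntax.
Variables (m : nat) (P Om : finType).

Inductive static_form : Type :=
  | SAtom of P
  | SNom of Om
  | SNeg of static_form
  | SAnd of static_form & static_form
  | SDia of 'I_m.+1 & static_form
  | SAt of Om & static_form.

Definition SOr (f g : static_form) := SNeg (SAnd (SNeg f) (SNeg g)).

(* f \/ f_1 \/ ... \/ f_n for s = [:: f_1; ...; f_n] *)
Definition SBigOr (f : static_form) (s : seq static_form) : static_form :=
  foldl SOr f s.

(* [DUpd j f] is the formula [F_j] f, for the j-th feed model of a family
   of k feed models. *)
Inductive dyn_form (k : nat) : Type :=
  | DAtom of P
  | DNom of Om
  | DNeg of dyn_form k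
  | DAnd of dyn_form k & dyn_form k
  | DDia of 'I_m.+1 & dyn_form k
  | DAt of Om & dyn_form k
  | DUpd of 'I_k & dyn_form k.

Inductive symbol (k : nat) : Type :=
  | YAtom of P
  | YNom of Om
  | YNeg
  | YAnd
  | YDia of 'I_m.+1
  | YAt of Om
  | YUpd of 'I_k.

Definition symbol_sum (k : nat) (y : symbol k) :
    (P + Om) + bool + ('I_m.+1 + Om + 'I_k) :=
  match y with
  | YAtom p => inl (inl (inl p))
  | YNom i => inl (inl (inr i))
  | YNeg => inl (inr false)
  | YAnd => inl (inr true)
  | YDia r => inr (inl (inl r))
  | YAt i => inr (inl (inr i))
  | YUpd j => inr (inr j)
  end.

Definition sum_symbol (k : nat)
    (u : (P + Om) + bool + ('I_m.+1 + Om + 'I_k)) : symbol k :=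
  match u with
  | inl (inl (inl p)) => YAtom k p
  | inl (inl (inr i)) => YNom k i
  | inl (inr false) => YNeg k
  | inl (inr true) => YAnd k
  | inr (inl (inl r)) => YDia k r
  | inr (inl (inr i)) => YAt k i
  | inr (inr j) => YUpd j
  end.

Lemma symbol_sumK (k : nat) : cancel (@symbol_sum k) (@sum_symbol k).
Proof. by case. Qed.

HB.instance Definition _ (k : nat) :=
  Finite.copy (symbol k) (can_type (@symbol_sumK k)).

(* Polish notation *)
Fixpoint dyn_word (k : nat) (f : dyn_form k) : seq (symbol k) :=
  match f with
  | DAtom p => [:: YAtom k p]
  | DNom i => [:: YNom k i]
  | DNeg g => YNeg k :: dyn_word g
  | DAnd g h => YAnd k :: dyn_word g ++ dyn_word h
  | DDia r g => YDia k r :: dyn_word g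
  | DAt i g => YAt k i :: dyn_word g
  | DUpd j g => YUpd j :: dyn_word g
  end.

Lemma dyn_word_cat_inj (k : nat) (f g : dyn_form k) (s t : seq (symbol k)) :
  dyn_word f ++ s = dyn_word g ++ t -> f = g /\ s = t.
Proof.
elim: f g s t => [p|i|f IH|f1 IH1 f2 IH2|r f IH|i f IH|j f IH]
  [q|i'|g|g1 g2|r' g|i' g|j' g] s t //=.
- by case=> -> ->.
- by case=> -> ->.
- by case=> /IH [-> ->].
- by rewrite -!catA => -[] /IH1 [->] /IH2 [-> ->].
- by case=> -> /IH [-> ->].
- by case=> -> /IH [-> ->].
- by case=> -> /IH [-> ->].
Qed.

Lemma dyn_word_inj (k : nat) : injective (@dyn_word k).
Proof.
move=> f g E; suff: dyn_word f ++ [::] = dyn_word g ++ [::].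
  by case/dyn_word_cat_inj.
by rewrite E.
Qed.

End Syntax.

Section Models.
Variables (R : realType) (m : nat) (A P Om : finType).

Record model := Model {
  sim : 'I_m.+1 -> rel A;
  interp : P + Om -> {set A}
}.

Definition naming (V : P + Om -> {set A}) : Prop :=
  exists2 name : Om -> A, bijective name
    & forall i : Om, V (inr i) = [set name i].

Definition static_model (M : model) : Prop :=
  [/\ naming (interp M),
      (forall r a, sim M r a a) /\
      (forall r a b, sim M r a b <-> sim M r b a),
      forall a b, sim M ord_max a b,
      forall (r s : 'I_m.+1) a b, (r <= s)%N -> sim M r a b -> sim M s a b
    & forall r s a b c, sim M r a b -> sim M s b c ->
        sim M (grid_oplus r s) a c].

Definition profile (V : P + Om -> {set A}) (a : A) : {set P} :=
  [set p | a \in V (inl p)].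

Definition profile_pseudometric (delta : {set P} -> {set P} -> R) : Prop :=
  [/\ forall S T, 0 <= delta S T <= 1,
      forall S, delta S S = 0,
      forall S T, delta S T = delta T S
    & forall S T U, delta S U <= delta S T + delta T U].

Definition grid_near (delta : {set P} -> {set P} -> R) (S T : {set P})
    (r : 'I_m.+1) : bool :=
  (grid_ceil m (delta S T) <= r)%N.

Definition network_model (delta : {set P} -> {set P} -> R) (M : model) :
    Prop :=
  naming (interp M) /\
  forall a b (r : 'I_m.+1),
    sim M r a b <->
    grid_near delta (profile (interp M) a) (profile (interp M) b) r.

Lemma network_model_static (delta : {set P} -> {set P} -> R) (M : model) :
  (0 < m)%N -> profile_pseudometric delta ->
  network_model delta M -> static_model M.
Proof.
move=> m_gt0 [d01 d0 dC dD] [nameM simM].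
have d1 S T : delta S T <= 1 by case/andP: (d01 S T).
have gnP S T r : grid_near delta S T r <-> delta S T <= grid_val R r.
  have [le_ceil ceil_min] := grid_ceilP m_gt0 (d1 S T).
  split; last exact: ceil_min.
  by rewrite /grid_near -(grid_val_le R) //; apply: le_trans.
split=> //.
- split=> [r a|r a b]; last by rewrite !simM /grid_near dC.
  by apply/simM/gnP; rewrite d0 divr_ge0 ?ler0n.
- by move=> a b; apply/simM/gnP; rewrite grid_val_max.
- by move=> r s a b rs /simM ab; apply/simM; apply: leq_trans rs.
- move=> r s a b c /simM/gnP ab /simM/gnP bc; apply/simM/gnP.
  rewrite grid_val_oplus // le_min d1 /=.
  by apply: le_trans (dD _ _ _) (lerD ab bc).
Qed.

Fixpoint sat (M : model) (f : static_form m P Om) (a : A) : bool :=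
  match f with
  | SAtom p => a \in interp M (inl p)
  | SNom i => a \in interp M (inr i)
  | SNeg g => ~~ sat M g a
  | SAnd g h => sat M g a && sat M h a
  | SDia r g => [exists b, sim M r a b && sat M g b]
  | SAt i g => [exists b, (interp M (inr i) == [set b]) && sat M g b]
  end.

Definition static_valid (f : static_form m P Om) : Prop :=
  forall M : model, static_model M -> forall a : A, sat M f a.

(* A feed model is given explicitly: the events are listed by a finType, and
   preconditions and postconditions are finite tables of formulas.  The match
   in [pre_total] states that the list of all preconditions is nonempty and
   that their disjunction is valid. *)
Record feed_model := FeedModel {
  event : finType;
  pre : {ffun event -> static_form m P Om};
  post : {ffun event * P -> static_form m P Om};
  pre_total :
    if [seq pre e | e <- enum event] is f :: s
    then static_valid (SBigOr f s) else False;
  pre_disjoint :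
    forall e f : event, e != f -> static_valid (SNeg (SAnd (pre e) (pre f)))
}.

(* On static models exactly one event is applicable at each agent, so there
   the result is never [None]. *)
Definition event_at (F : feed_model) (M : model) (a : A) : option (event F) :=
  [pick e | sat M (pre F e) a].

Lemma event_atP (F : feed_model) (M : model) (a : A) : static_model M ->
  exists e : event F, [/\ event_at F M a = Some e, sat M (pre F e) a
    & forall f, sat M (pre F f) a -> f = e].
Proof.
move=> stM; rewrite /event_at; case: pickP => [e e_a|none]; last first.
  suff: exists e, sat M (pre F e) a by case=> e; rewrite none.
  case E: [seq pre F e | e <- enum (event F)] (pre_total F) => [|f s] //.
  move=> /(_ M stM a) sat_or.
  have: has (fun g => sat M g a) (f :: s).
    elim: s f {E} sat_or => [|g s IH] f /=; first by rewrite orbF.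
    by move/IH => /=; rewrite negb_and !negbK -orbA.
  by rewrite -E has_map => /hasP [e _ /= ?]; exists e.
exists e; split=> // f f_a; apply/eqP/negPn/negP => /pre_disjoint.
by move=> /(_ M stM a) /=; rewrite f_a e_a.
Qed.

Definition update_interp (F : feed_model) (M : model) (q : P + Om) : {set A} :=
  match q with
  | inl p =>
      [set a | if event_at F M a is Some e then sat M (post F (e, p)) a
               else false]
  | inr i => interp M (inr i)
  end.

Definition update (delta : {set P} -> {set P} -> R) (M : model)
    (F : feed_model) : model :=
  let V := update_interp F M in
  Model (fun r a b => grid_near delta (profile V a) (profile V b) r) V.

Lemma update_network (delta : {set P} -> {set P} -> R) (M : model)
    (F : feed_model) :
  network_model delta M -> network_model delta (update delta M F).
Proof. by case=> [[name bij_name nameE] _]; split=> //; exists name. Qed.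

Section Dynamic.
Variables (delta : {set P} -> {set P} -> R) (k : nat).
Variable Sigma : 'I_k -> feed_model.

Fixpoint dyn_sat (M : model) (f : dyn_form m P Om k) (a : A) : bool :=
  match f with
  | DAtom p => a \in interp M (inl p)
  | DNom i => a \in interp M (inr i)
  | DNeg g => ~~ dyn_sat M g a
  | DAnd g h => dyn_sat M g a && dyn_sat M h a
  | DDia r g => [exists b, sim M r a b && dyn_sat M g b]
  | DAt i g => [exists b, (interp M (inr i) == [set b]) && dyn_sat M g b]
  | DUpd j g => dyn_sat (update delta M (Sigma j)) g a
  end.

Definition dyn_satisfiable (f : dyn_form m P Om k) : Prop :=
  exists M : model, network_model delta M /\ exists a : A, dyn_sat M f a.

Definition dyn_valid (f : dyn_form m P Om k) : Prop :=
  forall M : model, network_model delta M -> forall a : A, dyn_sat M f a.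

End Dynamic.

(* There are finitely many triples (S, T, r), so each is its own letter. *)
Definition decidable_grid_comparisons (delta : {set P} -> {set P} -> R) :
    Prop :=
  decidable_problem
    (fun x : {set P} * {set P} * 'I_m.+1 => [:: x])
    (fun x => grid_near delta x.1.1 x.1.2 x.2).

End Models.

(* Main.v *)
(* The truth of a formula at the agents of network models is recorded by a
   table indexed by the pairs of a valuation and an agent, since in a network
   model the valuation determines the relations.  There are finitely many such
   tables, and the table of a compound formula is computed from those of its
   immediate subformulas; for an update, by reading the given table at the
   updated valuation.  So a formula in Polish notation is evaluated by reading
   it from right to left with a stack of tables, and the formula is
   satisfiable, or valid, according to its table. *)
Require Import Defs.
From HB Require Import structures.
From mathcomp Require Import all_boot all_order all_algebra.
From mathcomp Require Import boolp reals.

Set Implicit Arguments.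
Unset Strict Implicit.
Unset Printing Implicit Defensive.

(** * Evaluation of words on a stack *)

Inductive stack_op (B : Type) : Type :=
  | Push of B
  | Map of (B -> B)
  | Merge of (B -> B -> B).

(** [None] signals stack underflow; the top entry is the first argument of [Merge]. *)
Definition exec (B : Type) (o : stack_op B) (st : seq B) : option (seq B) :=
  match o, st with
  | Push v, _ => Some (v :: st)
  | Map f, v :: st' => Some (f v :: st')
  | Merge g, u :: v :: st' => Some (g u v :: st')
  | _, _ => None
  end.

Definition stack_eval (X B : Type) (op : X -> stack_op B) (w : seq X) :
    option (seq B) :=
  foldr (fun x => obind (exec (op x))) (Some [::]) w.

Definition accepts (B : Type) (acc : pred B) (o : option (seq B)) : bool :=
  if o is Some [:: v] then acc v else false.

(* The machine moves to the right end of the input and then processes it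
   leftwards in place: the letters already read are overwritten by work letters
   [Some v], the entries of the stack with its top leftmost, and [None],
   a hole. *)
Inductive stack_state (X B : Type) : Type :=
  | Halt of bool
  | Seek
  | Back
  (* [Pop x o]: look for the next argument of the letter [x], whose first
     argument, if already found, is held in [o] *)
  | Pop of X & option B
  | Final of option B.

Arguments Halt {X B}.
Arguments Seek {X B}.
Arguments Back {X B}.
Arguments Final {X B}.

Definition stack_state_sum (X B : Type) (q : stack_state X B) :
    bool + bool + (X * option B + option B) :=
  match q with
  | Halt b => inl (inl b)
  | Seek => inl (inr true)
  | Back => inl (inr false)
  | Pop x o => inr (inl (x, o))
  | Final o => inr (inr o)
  end.

Definition sum_stack_state (X B : Type)
    (u : bool + bool + (X * option B + option B)) : stack_state X B :=
  match u with
  | inl (inl b) => Halt b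
  | inl (inr true) => Seek
  | inl (inr false) => Back
  | inr (inl (x, o)) => Pop x o
  | inr (inr o) => Final o
  end.

Lemma stack_state_sumK (X B : Type) :
  cancel (@stack_state_sum X B) (@sum_stack_state X B).
Proof. by case. Qed.

HB.instance Definition _ (X B : finType) :=
  Finite.copy (stack_state X B) (can_type (@stack_state_sumK X B)).

(** * A Turing machine that performs the stack evaluation *)

Section StackMachine.
Variables (X B : finType) (op : X -> stack_op B) (acc : pred B).

(** A result is written over the last argument found; the letter itself and an earlier argument
    become holes. A blank met in state [Pop] means underflow. *)
Definition stack_trans (q : stack_state X B) (h : option (X + option B)) :
    stack_state X B * option (X + option B) * bool :=
  match q with
  | Halt _ => (q, h, true)
  | Seek => if h is Some _ then (Seek, h, true) else (Back, None, false)
  | Back =>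
      match h with
      | None => (Final None, None, true)
      | Some (inl x) =>
          if op x is Push v then (Back, Some (inr (Some v)), false)
          else (Pop x None, Some (inr None), true)
      | Some (inr _) => (Back, h, false)
      end
  | Pop x o =>
      match h with
      | Some (inr None) => (q, h, true)
      | Some (inr (Some v)) =>
          match op x, o with
          | Map f, _ => (Back, Some (inr (Some (f v))), false)
          | Merge g, Some u => (Back, Some (inr (Some (g u v))), false)
          | Merge g, None => (Pop x (Some v), Some (inr None), true)
          | Push _, _ => (Halt false, h, true)
          end
      | _ => (Halt false, h, true)
      end
  | Final o =>
      match h, o with
      | Some (inr None), _ => (q, h, true)
      | Some (inr (Some v)), None => (Final (Some v), h, true)
      | None, Some v => (Halt (acc v), h, true)
      | _, _ => (Halt false, h, true)
      end
  end.

Definition stack_machine : turing_machine X :=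
  TuringMachine Seek (fun q => if q is Halt b then Some b else None)
    stack_trans.

Implicit Types (l s : seq (option B)) (w : seq X) (b : bool).

Let cell := tm_cell stack_machine.
Let work (y : option B) : cell := Some (inr y).
Let letter (x : X) : cell := Some (inl x).
(** The final blank is the cell where [Seek] turned back. *)
Let stack s : seq cell := map work s ++ [:: None].

Let conf (q : stack_state X B) (L T : seq cell) : tm_config stack_machine :=
  @TMConfig X stack_machine q L (head None T) (behead T).

(* [w] is the unread part of the input, from right to left. *)
Let ready w s : tm_config stack_machine :=
  conf Back (behead (map letter w)) (head None (map letter w) :: stack s).

Definition halts (c : tm_config stack_machine) b : Prop :=
  exists n, tm_verdict (tm_cur (iter n (@tm_step X stack_machine) c)) = Some b.

Lemma halts_step (c : tm_config stack_machine) b :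
  halts (tm_step c) b -> halts c b.
Proof. by case=> n; exists n.+1; rewrite iterSr. Qed.

(** [Back] leaves work letters unchanged, so each move left shifts one cell of [l] onto [s]. *)
Lemma halts_back l s w b :
  halts (ready w (catrev l s)) b ->
  halts (conf Back (behead (map work l ++ map letter w))
           (head None (map work l ++ map letter w) :: stack s)) b.
Proof.
elim: l s => [|y l IH] s //= H; apply: halts_step.
exact: IH (y :: s) H.
Qed.

Lemma pmap_catrev_holes l s :
  pmap id l = [::] -> pmap id (catrev l s) = pmap id s.
Proof. by elim: l s => [|[v|] l IH] s //= /IH ->. Qed.

(** Induction on the cells [s] still ahead: [l] holds the holes already passed, and [pmap id] reads
    the stack off the tape by dropping holes. *)
Lemma halts_pop x o l s w b :
  match op x, o with Map _, None | Merge _, _ => True | _, _ => False end ->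
  pmap id l = [::] ->
  (forall s', exec (op x) (seq_of_opt o ++ pmap id s) = Some (pmap id s') ->
     halts (ready w s') b) ->
  (exec (op x) (seq_of_opt o ++ pmap id s) = None -> b = false) ->
  halts (conf (Pop x o) (map work l ++ map letter w) (stack s)) b.
Proof.
elim: s o l => [|[v|] s IH] o l ox l0 Hs HN; apply: halts_step.
(* The blank is reached with an argument still missing. *)
- by exists 0; rewrite HN //; case: (op x) o ox {Hs HN} => [?|f|g] [u|].
- rewrite /tm_step /=; case E: (op x) o ox Hs HN => [?|f|g] [u|] // _ Hs HN.
  + apply: (@halts_back l (Some (f v) :: s)); apply: Hs.
    by rewrite pmap_catrev_holes.
  + apply: (@halts_back l (Some (g u v) :: s)); apply: Hs.
    by rewrite pmap_catrev_holes.
  (* The first argument of a [Merge] moves into the state and leaves a hole. *)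
  + by apply: (IH (Some v) (None :: l)); rewrite ?E.
- exact: (IH o (None :: l)).
Qed.

Lemma halts_final o L s :
  halts (conf (Final o) L (stack s))
    (accepts acc (Some (seq_of_opt o ++ pmap id s))).
Proof.
elim: s o L => [|[v|] s IH] [u|] L; apply: halts_step;
  by [exists 0 | apply: (IH (Some v)) | apply: IH].
Qed.

Lemma halts_ready w s :
  halts (ready w s)
    (accepts acc
       (foldl (fun o x => obind (exec (op x)) o) (Some (pmap id s)) w)).
Proof.
elim: w s => [|x w IH] s.
  by apply: halts_step; apply: (@halts_final None).
(* Underflow is permanent, which justifies rejecting at once. *)
have foldN : foldl (fun o x => obind (exec (op x)) o) None w = None.
  by elim: w {IH}.
have [[v Ex]|nonpush] : {v | op x = Push v} + (forall v, op x <> Push v).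
- by case: (op x) => [v|f|g]; [left; exists v | right | right].
- by apply: halts_step; rewrite /tm_step /= Ex; apply: (IH (Some v :: s)).
apply: halts_step; rewrite /tm_step /=.
have -> : (if op x is Push v then (Back, work (Some v), false)
    else (Pop x None, work None, true)) = (Pop x None, work None, true).
  by case: (op x) nonpush => // v /(_ v).
(* The single hole is the cell of the letter [x] itself. *)
apply: (@halts_pop x None [:: None]) => //.
- by case: (op x) nonpush => // v /(_ v).
- by move=> s' /= ->; apply: IH.
- by move=> /= ->; rewrite foldN.
Qed.

Lemma halts_seek w1 w2 b :
  halts (ready (catrev w2 w1) [::]) b ->
  halts (conf Seek (map letter w1) (map letter w2)) b.
Proof.
elim: w2 w1 => [|x w2 IH] w1 H; apply: halts_step => //.
exact: (IH (x :: w1)).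
Qed.

(** Since [B] is finite, stack entries can serve as work letters and be held in the state. *)
Lemma stack_decidable :
  decidable_language (fun w => accepts acc (stack_eval op w)).
Proof.
exists stack_machine => w.
have [n Hn] : halts (tm_init stack_machine w) (accepts acc (stack_eval op w)).
  apply: (@halts_seek [::] w); rewrite catrevE cats0.
  by have := halts_ready (rev w) [::]; rewrite foldl_rev.
by exists n, (accepts acc (stack_eval op w)).
Qed.

End StackMachine.

(** * Stack evaluation of Polish notation *)

Section PolishEvaluation.
Variables (m : nat) (P Om : finType) (k : nat) (B : Type).
Variables (op : symbol m P Om k -> stack_op B) (val : dyn_form m P Om k -> B).

(** Compositionality: each letter computes the value of a formula from the values of its immediate
    subformulas. *)
Hypothesis op_val : forall y : symbol m P Om k,
  match y with
  | YAtom p => op y = Push (val (DAtom m Om k p))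
  | YNom i => op y = Push (val (DNom m P k i))
  | YNeg => exists2 h, op y = Map h & forall f, h (val f) = val (DNeg f)
  | YAnd => exists2 h, op y = Merge h &
      forall f g, h (val f) (val g) = val (DAnd f g)
  | YDia r => exists2 h, op y = Map h & forall f, h (val f) = val (DDia r f)
  | YAt i => exists2 h, op y = Map h & forall f, h (val f) = val (DAt i f)
  | YUpd j => exists2 h, op y = Map h & forall f, h (val f) = val (DUpd j f)
  end.

(** The suffix [w] is general because the first conjunct is followed by the second. *)
Lemma stack_eval_word f w :
  stack_eval op (dyn_word f ++ w) = omap (cons (val f)) (stack_eval op w).
Proof.
elim: f w => [p|i|f IH|f IHf g IHg|r f IH|i f IH|j f IH] w /=.
- by rewrite (op_val (YAtom _ _ _ p)); case: (stack_eval op w).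
- by rewrite (op_val (YNom _ _ _ i)); case: (stack_eval op w).
- have [h -> hE] := op_val (YNeg _ _ _ _).
  rewrite -/(stack_eval op _) IH.
  by case: (stack_eval op w) => //= st; rewrite hE.
- have [h -> hE] := op_val (YAnd _ _ _ _).
  rewrite -/(stack_eval op _) -catA IHf IHg.
  by case: (stack_eval op w) => //= st; rewrite hE.
- have [h -> hE] := op_val (YDia _ _ _ r).
  rewrite -/(stack_eval op _) IH.
  by case: (stack_eval op w) => //= st; rewrite hE.
- have [h -> hE] := op_val (YAt _ _ _ i).
  rewrite -/(stack_eval op _) IH.
  by case: (stack_eval op w) => //= st; rewrite hE.
- have [h -> hE] := op_val (YUpd _ _ _ j).
  rewrite -/(stack_eval op _) IH.
  by case: (stack_eval op w) => //= st; rewrite hE.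
Qed.

(** This converse ensures that words encoding no formula are rejected: without underflow, each
    letter either starts a new formula or combines those on top. *)
Lemma stack_eval_inv w st : stack_eval op w = Some st ->
  exists2 fs, w = flatten (map (@dyn_word m P Om k) fs) & st = map val fs.
Proof.
elim: w st => [|y w IH] st /=; first by case=> <-; exists [::].
rewrite -/(stack_eval op w); case: (stack_eval op w) IH => //= st' /(_ _ erefl).
case=> fs -> -> {st'}.
case: y (op_val y) => [p -> [<-]|i -> [<-]|[h -> hE]|[h -> hE]|
  r [h -> hE]|i [h -> hE]|j [h -> hE]].
- by exists (DAtom m Om k p :: fs).
- by exists (DNom m P k i :: fs).
- by case: fs => //= f fs [<-]; exists (DNeg f :: fs); rewrite ?hE.
- case: fs => [|f [|g fs]] //= [<-]; exists (DAnd f g :: fs); rewrite /= ?hE //.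
  by rewrite catA.
- by case: fs => //= f fs [<-]; exists (DDia r f :: fs); rewrite ?hE.
- by case: fs => //= f fs [<-]; exists (DAt i f :: fs); rewrite ?hE.
- by case: fs => //= f fs [<-]; exists (DUpd j f :: fs); rewrite ?hE.
Qed.

Lemma accepts_word (acc : pred B) w :
  accepts acc (stack_eval op w) <-> exists2 f, w = dyn_word f & acc (val f).
Proof.
split; last first.
  by case=> f -> fT; rewrite -[dyn_word f]cats0 stack_eval_word.
rewrite /accepts; case E: (stack_eval op w) => [[|v []]|] //.
have [[|f []] //= -> [->]] := stack_eval_inv E.
by rewrite cats0; exists f.
Qed.

End PolishEvaluation.

Lemma decidable_problem_table (m : nat) (P Om : finType) (k : nat)
    (B : finType) (op : symbol m P Om k -> stack_op B)
    (val : dyn_form m P Om k -> B) (acc : pred B)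
    (Q : dyn_form m P Om k -> Prop) :
  (forall w, accepts acc (stack_eval op w) <->
     exists2 f, w = dyn_word f & acc (val f)) ->
  (forall f, acc (val f) <-> Q f) ->
  decidable_problem (@dyn_word m P Om k) Q.
Proof.
move=> accE accQ; have [T decT] := stack_decidable op acc.
exists T => w; have [n [b [nb bE]]] := decT w; exists n, b; split=> //.
rewrite bE accE.
by split=> -[f -> /accQ ?]; exists f.
Qed.

(** * Finite truth tables over all valuations *)

Section TruthTables.
Variables (R : realType) (m : nat) (A P Om : finType) (k : nat).
Variables (Sigma : 'I_k -> feed_model m A P Om).
Variable delta : {set P} -> {set P} -> R.

Local Notation valuation := {ffun P + Om -> {set A}}.
Local Notation table := {ffun valuation * A -> bool}.

Definition valuation_model (V : P + Om -> {set A}) : model m A P Om :=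
  Model (fun r a b => grid_near delta (profile V a) (profile V b) r) V.

Lemma network_modelE (M : model m A P Om) :
  network_model delta M -> M = valuation_model (interp M).
Proof.
case: M => s V [_ /= sE]; congr Model.
apply/funext => r; apply/funext => a; apply/funext => b.
by apply/idP/idP => /sE.
Qed.

Lemma valuation_model_finfun (V : P + Om -> {set A}) :
  valuation_model (finfun V) = valuation_model V.
Proof. by congr valuation_model; apply/funext => q; rewrite ffunE. Qed.

(** Valuations that violate naming also get entries; [is_network] filters them out at acceptance. *)
Definition truth_table (f : dyn_form m P Om k) : table :=
  [ffun p : valuation * A =>
    dyn_sat delta Sigma (valuation_model p.1) f p.2].

(** With [delta] and [Sigma] fixed, each operation is a fixed map on a finite set, so it can be
    built into a transition table. *)
Definition table_op (y : symbol m P Om k) : stack_op table :=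
  match y with
  | YAtom p => Push (truth_table (DAtom m Om k p))
  | YNom i => Push (truth_table (DNom m P k i))
  | YNeg => Map (fun t : table => [ffun p => ~~ t p])
  | YAnd => Merge (fun t u : table => [ffun p => t p && u p])
  | YDia r => Map (fun t : table => [ffun p : valuation * A =>
      [exists b, sim (valuation_model p.1) r p.2 b && t (p.1, b)]])
  | YAt i => Map (fun t : table => [ffun p : valuation * A =>
      [exists b, (p.1 (inr i) == [set b]) && t (p.1, b)]])
  | YUpd j => Map (fun t : table => [ffun p : valuation * A =>
      t (finfun (update_interp (Sigma j) (valuation_model p.1)), p.2)])
  end.

Lemma accepts_table (acc : pred table) w :
  accepts acc (stack_eval table_op w) <->
  exists2 f, w = dyn_word f & acc (truth_table f).
Proof.
apply: accepts_word => -[p|i|||r|i|j] //=; eexists; try reflexivity.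
- by move=> f; apply/ffunP => p; rewrite !ffunE.
- by move=> f g; apply/ffunP => p; rewrite !ffunE.
- move=> f; apply/ffunP => p; rewrite !ffunE /=.
  by apply: eq_existsb => b; rewrite ffunE.
- move=> f; apply/ffunP => p; rewrite !ffunE /=.
  by apply: eq_existsb => b; rewrite ffunE.
(* An updated model is by definition the [valuation_model] of its updated valuation. *)
- by move=> f; apply/ffunP => p; rewrite !ffunE /= valuation_model_finfun.
Qed.

Definition is_network (V : valuation) : bool :=
  `[< network_model delta (valuation_model V) >].

Definition somewhere_true (t : table) : bool :=
  [exists p : valuation * A, is_network p.1 && t p].

Definition everywhere_true (t : table) : bool :=
  [forall p : valuation * A, is_network p.1 ==> t p].

Lemma somewhere_true_table f :
  somewhere_true (truth_table f) <-> dyn_satisfiable delta Sigma f.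
Proof.
split=> [/existsP[[V a] /andP[/asboolP netV]]|[M [netM [a fa]]]].
  by rewrite ffunE => fa; exists (valuation_model V); split=> //; exists a.
apply/existsP => /=; exists (finfun (interp M), a).
rewrite /is_network ffunE /= valuation_model_finfun -network_modelE // fa andbT.
exact/asboolP.
Qed.

Lemma everywhere_true_table f :
  everywhere_true (truth_table f) <-> dyn_valid delta Sigma f.
Proof.
split=> [/forallP tf M netM a|fT].
  have := tf (finfun (interp M), a).
  rewrite /is_network ffunE /= valuation_model_finfun -network_modelE //.
  by rewrite asboolT.
by apply/forallP => p; apply/implyP => /asboolP netV; rewrite ffunE; apply: fT.
Qed.

End TruthTables.

Theorem corollary4p5 (R : realType) (m : nat) (A P Om : finType)
    (m_gt0 : (0 < m)%N) (A_gt0 : (0 < #|A|)%N) (P_gt0 : (0 < #|P|)%N)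
    (card_Om : #|Om| = #|A|)
    (k : nat) (Sigma : 'I_k -> feed_model m A P Om)
    (delta : {set P} -> {set P} -> R)
    (delta_pm : profile_pseudometric delta)
    (delta_dec : decidable_grid_comparisons m delta) :
  decidable_problem (@dyn_word m P Om k) (dyn_satisfiable delta Sigma) /\
  decidable_problem (@dyn_word m P Om k) (dyn_valid delta Sigma).
Proof.
split.
- exact: decidable_problem_table (accepts_table Sigma delta _)
    (somewhere_true_table Sigma delta).
- exact: decidable_problem_table (accepts_table Sigma delta _)
    (everywhere_true_table Sigma delta).
Qed.
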